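(* Let $a$ be a complex number not equal to a non-zero integer. Then $$\sum_{k=1}^{\infty}\frac{1}{k(k^2-a^2)}=\sum_{n=1}^{\infty}\frac{a^4-a^2(32n^2-10n+1)+2n^2(56n^2-32n+5)}{2n^3\binom{2n}{n}\binom{3n}{n}\,((2n-1)^2-a^2)(4n^2-a^2)}\prod_{m=1}^{n-1}\left(\frac{a^2}{m^2}-1\right).$$
   Context: An empty product (the case $n=1$) equals $1$. *)

(* Defs.v *)
From Stdlib Require Import Reals ZArith.
From Coquelicot Require Export Coquelicot.

Open Scope C_scope.

(* Multiplicative analogue of Coquelicot's [sum_n_m], bounds included: the
   product is empty, hence 1, as soon as m < n. *)
Definition Cprod_n_m (f : nat -> C) (n m : nat) : C :=
  Iter.iter_nat Cmult (RtoC 1) f n m.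

(* The two summands are meant for positive indices only; at index 0 they
   involve a division by 0. *)
Definition lhs_term (a : C) (k : nat) : C :=
  let k := RtoC (INR k) in
  1 / (k * (k ^ 2 - a ^ 2)).

(* [Binomial.C p q] is the binomial coefficient "p choose q" as a real number;
   it is unrelated to the type [C] of complex numbers. *)
Definition rhs_term (a : C) (n : nat) : C :=
  let x := RtoC (INR n) in
  (a ^ 4 - a ^ 2 * (32 * x ^ 2 - 10 * x + 1)
     + 2 * x ^ 2 * (56 * x ^ 2 - 32 * x + 5))
  / (2 * x ^ 3 * RtoC (Binomial.C (2 * n) n) * RtoC (Binomial.C (3 * n) n)
     * ((2 * x - 1) ^ 2 - a ^ 2) * (4 * x ^ 2 - a ^ 2))
  * Cprod_n_m (fun m => a ^ 2 / RtoC (INR m) ^ 2 - 1) 1 (n - 1).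

(* Main.v *)
(* With R_n = prod_(m=1)^n (a^2/m^2 - 1), the functions
     A(n,k) = R_n n!^2 (k-n-1)! / ((k+n)! (k^2 - a^2)),
     B(n,k) = R_n n!^2 (k-n-2)! / ((k+n)! (2n+2))
   form a WZ pair: A(n+1,k) - A(n,k) = B(n,k+1) - B(n,k), and A(0,k) is the
   k-th term of the left-hand series. Summing the WZ equation over the region
   under the staircase k = 2n+1 turns the row k = 1, 2, ..., 2N+2 of A(0,-) into
   the sum over n <= N of A(n,2n+1) + A(n,2n+2) + B(n,2n+3), which is the term of
   index n+1 of the right-hand series, minus the boundary terms B(n,2N+3).
   The latter are O(1/N^2) uniformly in n <= N, so their sum tends to 0. *)

Require Import Defs.
From Stdlib Require Import Reals ZArith Lra Lia.
From Coquelicot Require Import Coquelicot.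

Open Scope C_scope.

(** * The WZ pair and its recurrences *)

(** Sums in Coquelicot are stated with the abstract [plus] and [zero]; these and the carrier are
    made concrete so that [ring] recognizes the complex field. *)
Ltac C_ring :=
  change plus with Cplus; change zero with (RtoC 0);
  match goal with |- @eq _ ?x ?y => change (@eq C x y) end; ring.

(** The product R_n: up to the sign (-1)^n, a partial product of Euler's product for sin(pi a)/(pi
    a). *)
Definition sine_prod (a : C) (n : nat) : C :=
  Cprod_n_m (fun m => a ^ 2 / RtoC (INR m) ^ 2 - 1) 1 n.

(* Meant for n < k: the subtraction on [nat] is truncated. *)
Definition wz_coef (n k : nat) : R :=
  (INR (fact n) ^ 2 * INR (fact (k - n - 1)) / INR (fact (k + n)))%R.

Definition wz_kernel (a : C) (n k : nat) : C := sine_prod a n * RtoC (wz_coef n k).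

Definition wz_A (a : C) (n k : nat) : C :=
  wz_kernel a n k / (RtoC (INR k) ^ 2 - a ^ 2).

(** Here (k-n-2)! is written as (k-n-1)!/(k-n-1), so that [wz_A] and [wz_B] share one kernel;
    meaningful for k >= n+2. *)
Definition wz_B (a : C) (n k : nat) : C :=
  wz_kernel a n k / RtoC ((INR k - INR n - 1) * (2 * INR n + 2)).

Lemma sine_prod_S (a : C) (n : nat) :
  sine_prod a (S n) = sine_prod a n * (a ^ 2 / RtoC (INR (S n)) ^ 2 - 1).
Proof.
  unfold sine_prod, Cprod_n_m.
  rewrite (Iter.iter_nat_Chasles Cmult (RtoC 1) Cmult_1_l Cmult_assoc _ 1 n (S n)) by lia.
  rewrite (Iter.iter_nat_point Cmult (RtoC 1) Cmult_1_r); reflexivity.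
Qed.

Lemma INR_fact_S (n : nat) : INR (fact (S n)) = (INR (S n) * INR (fact n))%R.
Proof. rewrite fact_simpl; apply mult_INR. Qed.

Lemma wz_coef_Sn (n k : nat) : (S n < k)%nat ->
  wz_coef (S n) k
  = (wz_coef n k * INR (S n) ^ 2 / (INR k ^ 2 - INR (S n) ^ 2))%R.
Proof.
  intros H; unfold wz_coef.
  (* Writing k as j+n+2 turns the truncated subtractions into plain naturals. *)
  destruct (Nat.le_exists_sub (S (S n)) k H) as [j [-> _]].
  replace (j + S (S n) - S n - 1)%nat with j by lia.
  replace (j + S (S n) - n - 1)%nat with (S j) by lia.
  replace (j + S (S n) + S n)%nat with (S (j + S (S n) + n)) by lia.
  rewrite !INR_fact_S.
  pose proof (INR_fact_neq_0 n); pose proof (INR_fact_neq_0 j).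
  pose proof (INR_fact_neq_0 (j + S (S n) + n)).
  rewrite ?S_INR, ?plus_INR, ?S_INR.
  pose proof (pos_INR j); pose proof (pos_INR n).
  field; repeat split; try assumption; nra.
Qed.

Lemma wz_coef_Sk (n k : nat) : (n < k)%nat ->
  wz_coef n (S k) = (wz_coef n k * (INR k - INR n) / (INR k + INR n + 1))%R.
Proof.
  intros H; unfold wz_coef.
  destruct (Nat.le_exists_sub (S n) k H) as [j [-> _]].
  replace (S (j + S n) - n - 1)%nat with (S j) by lia.
  replace (j + S n - n - 1)%nat with j by lia.
  replace (S (j + S n) + n)%nat with (S (j + S n + n)) by lia.
  rewrite !INR_fact_S.
  pose proof (INR_fact_neq_0 (j + S n + n)).
  rewrite ?S_INR, ?plus_INR, ?S_INR.
  pose proof (pos_INR j); pose proof (pos_INR n).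
  field; repeat split; try assumption; nra.
Qed.

Lemma RtoC_neq (x y : R) : x <> y -> RtoC x <> RtoC y.
Proof. intros H E; apply H, RtoC_inj, E. Qed.

Lemma sqr_sub_neq_0 (a : C) (k : nat) :
  (forall z : Z, z <> 0%Z -> a <> RtoC (IZR z)) -> (0 < k)%nat ->
  RtoC (INR k) ^ 2 - a ^ 2 <> 0.
Proof.
  intros ha Hk.
  replace (RtoC (INR k) ^ 2 - a ^ 2)
    with ((RtoC (INR k) - a) * (RtoC (INR k) + a)) by ring.
  apply Cmult_neq_0; intros E.
  - apply (ha (Z.of_nat k)); [lia|].
    rewrite <- INR_IZR_INZ.
    replace a with (RtoC (INR k) - (RtoC (INR k) - a)) by ring.
    rewrite E; ring.
  - apply (ha (- Z.of_nat k)%Z); [lia|].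
    rewrite opp_IZR, <- INR_IZR_INZ, RtoC_opp.
    replace a with (RtoC (INR k) + a - RtoC (INR k)) by ring.
    rewrite E; ring.
Qed.

(** The factor (n+1)^2 gained from the factorials clears the denominator of the new factor
    a^2/(n+1)^2 - 1 of R. *)
Lemma wz_kernel_Sn (a : C) (n k : nat) : (S n < k)%nat ->
  wz_kernel a (S n) k
  = wz_kernel a n k * (a ^ 2 - RtoC (INR (S n)) ^ 2)
    * RtoC (/ (INR k ^ 2 - INR (S n) ^ 2)).
Proof.
  intros H; unfold wz_kernel.
  rewrite sine_prod_S, wz_coef_Sn by assumption.
  unfold Rdiv; rewrite !RtoC_mult, RtoC_pow.
  field. apply RtoC_neq, not_0_INR; discriminate.
Qed.

Lemma wz_kernel_Sk (a : C) (n k : nat) : (n < k)%nat ->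
  wz_kernel a n (S k)
  = wz_kernel a n k * RtoC ((INR k - INR n) / (INR k + INR n + 1)).
Proof.
  intros H; unfold wz_kernel.
  rewrite wz_coef_Sk by assumption.
  unfold Rdiv; rewrite !RtoC_mult; ring.
Qed.

(** * The WZ equation and the terms on the staircase *)

(** Both sides equal -[wz_kernel a n k] / (k^2 - (n+1)^2): on the left the factor k^2 - a^2 cancels,
    on the right 1/(k+n+1) - 1/(k-n-1) produces the factor 2n+2 that cancels. *)
Lemma wz_equation (a : C) (n k : nat) :
  (S n < k)%nat -> RtoC (INR k) ^ 2 - a ^ 2 <> 0 ->
  wz_A a (S n) k - wz_A a n k = wz_B a n (S k) - wz_B a n k.
Proof.
  intros H Ha; unfold wz_A, wz_B.
  rewrite wz_kernel_Sn, wz_kernel_Sk by lia.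
  pose proof (lt_INR _ _ H) as H'.
  pose proof (pos_INR n).
  rewrite !S_INR in *.
  rewrite RtoC_inv by nra.
  assert (0 < INR k + INR n + 1)%R by lra.
  unfold Rdiv; rewrite !RtoC_mult, RtoC_inv by lra.
  assert (N1 : RtoC (INR k + INR n + 1) <> 0) by (apply RtoC_neq; lra).
  assert (N2 : RtoC (INR k - INR n - 1) <> 0) by (apply RtoC_neq; lra).
  assert (N3 : RtoC (2 * INR n + 2) <> 0) by (apply RtoC_neq; lra).
  assert (N4 : RtoC (INR k - INR n) <> 0) by (apply RtoC_neq; lra).
  replace (INR k + 1 - INR n - 1)%R with (INR k - INR n)%R by ring.
  replace (INR k ^ 2 - (INR n + 1) ^ 2)%R
    with ((INR k - INR n - 1) * (INR k + INR n + 1))%R by ring.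
  rewrite RtoC_mult.
  revert N1 N2 N3 N4.
  rewrite ?RtoC_minus, ?RtoC_plus, ?RtoC_mult, ?RtoC_minus, ?RtoC_plus.
  intros; field; repeat split; assumption.
Qed.

Lemma wz_diagonal (a : C) (n : nat) :
  (forall z : Z, z <> 0%Z -> a <> RtoC (IZR z)) ->
  wz_A a n (2 * n + 1) + wz_A a n (2 * n + 2) + wz_B a n (2 * n + 3)
  = rhs_term a (S n).
Proof.
  intros ha.
  pose proof (sqr_sub_neq_0 a (2 * n + 1) ha ltac:(lia)) as H1.
  pose proof (sqr_sub_neq_0 a (2 * n + 2) ha ltac:(lia)) as H2.
  unfold rhs_term, wz_A, wz_B.
  replace (S n - 1)%nat with n by lia.
  fold (sine_prod a n); unfold wz_kernel, wz_coef, Binomial.C.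
  replace (2 * n + 1 - n - 1)%nat with n by lia.
  replace (2 * n + 2 - n - 1)%nat with (S n) by lia.
  replace (2 * n + 3 - n - 1)%nat with (S (S n)) by lia.
  replace (2 * n + 1 + n)%nat with (S (3 * n)) by lia.
  replace (2 * n + 2 + n)%nat with (S (S (3 * n))) by lia.
  replace (2 * n + 3 + n)%nat with (S (S (S (3 * n)))) by lia.
  replace (3 * S n)%nat with (S (S (S (3 * n)))) by lia.
  replace (S (S (S (3 * n))) - S n)%nat with (2 * S n)%nat by lia.
  replace (2 * S n - S n)%nat with (S n) by lia.
  pose proof (INR_fact_neq_0 (2 * S n)) as Hm.
  rewrite !INR_fact_S.
  pose proof (INR_fact_neq_0 n) as Hn.
  pose proof (INR_fact_neq_0 (3 * n)) as H3.
  revert Hn H3 Hm H1 H2.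
  (* With n!, (3n)! and (2n+2)! as nonzero atoms, a rational identity in n and a remains; (2n+2)!
     cancels between the two binomials. *)
  generalize (INR (fact n)) (INR (fact (3 * n))) (INR (fact (2 * S n))).
  intros f g h.
  rewrite ?S_INR, ?plus_INR, ?mult_INR, ?S_INR.
  pose proof (pos_INR n) as Hx; revert Hx; simpl (INR 0); simpl (INR 1).
  generalize (INR n); intros x Hx Hf Hg Hh H1 H2.
  replace (0 + 1 + 1 + 1)%R with 3%R in * by ring.
  replace (0 + 1 + 1)%R with 2%R in * by ring.
  replace (0 + 1)%R with 1%R in * by ring.
  replace (2 * x + 3 - x - 1)%R with (x + 1 + 1)%R by ring.
  unfold Rdiv; rewrite ?Rinv_mult, ?RtoC_mult, ?RtoC_inv by (assumption || lra).
  assert (N1 : RtoC (3 * x + 1) <> 0) by (apply RtoC_neq; lra).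
  assert (N2 : RtoC (3 * x + 1 + 1) <> 0) by (apply RtoC_neq; lra).
  assert (N3 : RtoC (3 * x + 1 + 1 + 1) <> 0) by (apply RtoC_neq; lra).
  assert (N4 : RtoC (x + 1) <> 0) by (apply RtoC_neq; lra).
  assert (N5 : RtoC (x + 1 + 1) <> 0) by (apply RtoC_neq; lra).
  assert (N6 : RtoC (2 * x + 2) <> 0) by (apply RtoC_neq; lra).
  apply RtoC_neq in Hf; apply RtoC_neq in Hg; apply RtoC_neq in Hh.
  revert H1 H2 N1 N2 N3 N4 N5 N6.
  rewrite ?RtoC_plus, ?RtoC_mult, ?RtoC_plus, ?RtoC_mult, ?RtoC_pow, ?RtoC_plus.
  intros.
  field; repeat split; try assumption; intros E.
  (* The last two denominators are, up to [ring], k^2 - a^2 at k = 2n+2 and k = 2n+1. *)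
  - apply H2; rewrite <- E; ring.
  - apply H1; rewrite <- E; ring.
Qed.

Lemma wz_A_0 (a : C) (k : nat) :
  (forall z : Z, z <> 0%Z -> a <> RtoC (IZR z)) ->
  wz_A a 0 (S k) = lhs_term a (S k).
Proof.
  intros ha; pose proof (sqr_sub_neq_0 a (S k) ha ltac:(lia)) as H.
  unfold wz_A, lhs_term, wz_kernel, wz_coef.
  replace (S k - 0 - 1)%nat with k by lia.
  rewrite Nat.add_0_r, INR_fact_S.
  change (sine_prod a 0) with (RtoC 1).
  replace (INR (fact 0) ^ 2 * INR (fact k) / (INR (S k) * INR (fact k)))%R
    with (/ INR (S k))%R.
  - rewrite RtoC_inv by (apply not_0_INR; lia).
    field; split; [assumption | apply RtoC_neq, not_0_INR; lia].
  - change (INR (fact 0)) with 1%R.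
    field; split; [apply INR_fact_neq_0 | apply not_0_INR; lia].
Qed.

(** * Summation under the staircase *)

(** The first two entries of row n are kept; from k = 2n+3 on, the WZ equation replaces row n by row
    n+1. The differences of B telescope, and their lower end B(n,2n+3) completes the kept entries to
    [rhs_term a (S n)]. *)
Lemma wz_row (a : C) (n i : nat) :
  (forall z : Z, z <> 0%Z -> a <> RtoC (IZR z)) ->
  sum_n_m (wz_A a n) (2 * n + 1) (2 * n + 2 + i)
  = rhs_term a (S n) - wz_B a n (2 * n + 3 + i)
    + sum_n_m (wz_A a (S n)) (2 * n + 3) (2 * n + 2 + i).
Proof.
  intros ha; induction i as [|i IH].
  - rewrite Nat.add_0_r.
    rewrite (sum_n_m_zero (wz_A a (S n))) by lia.
    replace (2 * n + 2)%nat with (S (2 * n + 1)) by lia.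
    rewrite sum_n_Sm by lia; rewrite sum_n_n.
    rewrite <- wz_diagonal by assumption.
    replace (2 * n + 2)%nat with (S (2 * n + 1)) by lia.
    rewrite Nat.add_0_r.
    C_ring.
  - replace (2 * n + 2 + S i)%nat with (S (2 * n + 2 + i)) by lia.
    rewrite 2!sum_n_Sm by lia; rewrite IH.
    pose proof (wz_equation a n (S (2 * n + 2 + i)) ltac:(lia)
                  (sqr_sub_neq_0 a (S (2 * n + 2 + i)) ha ltac:(lia))) as E.
    replace (2 * n + 3 + S i)%nat with (S (S (2 * n + 2 + i))) by lia.
    replace (2 * n + 3 + i)%nat with (S (2 * n + 2 + i)) by lia.
    replace (wz_A a n (S (2 * n + 2 + i)))
      with (wz_A a (S n) (S (2 * n + 2 + i))
            - (wz_A a (S n) (S (2 * n + 2 + i)) - wz_A a n (S (2 * n + 2 + i))))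
      by ring.
    rewrite E; C_ring.
Qed.

(** Iterates [wz_row] at the fixed cutoff k = 2N+2; the last sum is the part of row n+1 not yet
    processed. *)
Lemma wz_staircase (a : C) (N n : nat) :
  (forall z : Z, z <> 0%Z -> a <> RtoC (IZR z)) -> (n <= N)%nat ->
  sum_n_m (wz_A a 0) 1 (2 * N + 2)
  = sum_n (fun i => rhs_term a (S i)) n
    - sum_n (fun i => wz_B a i (2 * N + 3)) n
    + sum_n_m (wz_A a (S n)) (2 * n + 3) (2 * N + 2).
Proof.
  intros ha; induction n as [|n IH]; intros Hn.
  - rewrite !sum_O.
    replace (2 * N + 2)%nat with (2 * 0 + 2 + 2 * N)%nat by lia.
    replace (2 * N + 3)%nat with (2 * 0 + 3 + 2 * N)%nat by lia.
    apply (wz_row a 0); assumption.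
  - rewrite IH by lia; rewrite !sum_Sn.
    (* This length makes row n+1 stop exactly at k = 2N+2. *)
    pose proof (wz_row a (S n) (2 * (N - S n)) ha) as E.
    replace (2 * S n + 2 + 2 * (N - S n))%nat with (2 * N + 2)%nat in E by lia.
    replace (2 * S n + 3 + 2 * (N - S n))%nat with (2 * N + 3)%nat in E by lia.
    replace (2 * n + 3)%nat with (2 * S n + 1)%nat by lia.
    rewrite E; C_ring.
Qed.

Lemma partial_sum_rhs (a : C) (N : nat) :
  (forall z : Z, z <> 0%Z -> a <> RtoC (IZR z)) ->
  sum_n (fun i => rhs_term a (S i)) N
  = sum_n (fun j => lhs_term a (S j)) (2 * N + 1)
    + sum_n (fun i => wz_B a i (2 * N + 3)) N.
Proof.
  intros ha; pose proof (wz_staircase a N N ha (le_n N)) as E.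
  (* At n = N the remaining row runs from 2N+3 to 2N+2, hence is empty. *)
  rewrite (sum_n_m_zero (wz_A a (S N))) in E by lia.
  replace (2 * N + 2)%nat with (S (2 * N + 1)) in E by lia.
  rewrite <- (sum_n_m_S (wz_A a 0)) in E.
  fold (sum_n (fun j => wz_A a 0 (S j)) (2 * N + 1)) in E.
  rewrite (sum_n_ext _ (fun j => lhs_term a (S j))) in E
    by (intros j; apply wz_A_0; assumption).
  assert (H : forall x y z : C, z = x - y + 0 -> x = z + y)
    by (intros x y z ->; ring).
  apply H, E.
Qed.

(** * Vanishing of the boundary terms *)

Lemma Cmod_sqr (z : C) : Cmod (z ^ 2) = (Cmod z ^ 2)%R.
Proof. simpl; rewrite !Cmod_mult, Cmod_1; reflexivity. Qed.

(** At n = 0 the kernel is exactly 1/(2N+3), and each step in n multiplies it by a factor of modulus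
    at most 1, since |a|^2 + (n+1)^2 <= 2N^2 <= (2N+3)^2 - (n+1)^2. *)
Lemma wz_kernel_bound (a : C) (N n : nat) :
  (Cmod a <= INR N)%R -> (n <= N)%nat ->
  (Cmod (wz_kernel a n (2 * N + 3)) <= / INR (2 * N + 3))%R.
Proof.
  intros Ha; induction n as [|n IH]; intros Hn.
  - unfold wz_kernel, wz_coef; change (sine_prod a 0) with (RtoC 1).
    replace (2 * N + 3 - 0 - 1)%nat with (2 * N + 2)%nat by lia.
    replace (2 * N + 3 + 0)%nat with (S (2 * N + 2)) by lia.
    replace (2 * N + 3)%nat with (S (2 * N + 2)) by lia.
    rewrite INR_fact_S, Cmult_1_l, Cmod_R; change (INR (fact 0)) with 1%R.
    pose proof (INR_fact_neq_0 (2 * N + 2)).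
    pose proof (lt_0_INR (S (2 * N + 2)) ltac:(lia)).
    replace (1 ^ 2 * INR (fact (2 * N + 2))
             / (INR (S (2 * N + 2)) * INR (fact (2 * N + 2))))%R
      with (/ INR (S (2 * N + 2)))%R by (field; lra).
    rewrite Rabs_pos_eq; [lra | left; apply Rinv_0_lt_compat; assumption].
  - rewrite wz_kernel_Sn by lia.
    rewrite 2!Cmod_mult, Cmod_R.
    assert (Hm : (INR (S n) <= INR N)%R) by (apply le_INR; lia).
    pose proof (pos_INR (S n)) as Hm0.
    assert (HK : INR (2 * N + 3) = (2 * INR N + 3)%R)
      by (rewrite plus_INR, mult_INR; simpl; ring).
    assert (Hd : (0 < INR (2 * N + 3) ^ 2 - INR (S n) ^ 2)%R) by (rewrite HK; nra).
    rewrite (Rabs_pos_eq (/ _)) by (left; apply Rinv_0_lt_compat, Hd).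
    assert (Hnum : (Cmod (a ^ 2 - RtoC (INR (S n)) ^ 2)
                    <= INR (2 * N + 3) ^ 2 - INR (S n) ^ 2)%R).
    { eapply Rle_trans; [apply Cmod_triangle|].
      rewrite Cmod_opp, !Cmod_sqr, Cmod_R, Rabs_pos_eq by assumption.
      pose proof (Cmod_ge_0 a); rewrite HK; nra. }
    specialize (IH ltac:(lia)).
    apply Rle_trans with (2 := IH).
    rewrite Rmult_assoc; rewrite <- (Rmult_1_r (Cmod (wz_kernel _ _ _))) at 2.
    apply Rmult_le_compat_l; [apply Cmod_ge_0|].
    apply (Rmult_le_reg_r _ _ _ Hd).
    rewrite Rmult_assoc, Rinv_l by lra; lra.
Qed.

(** One factor 1/(N+1) comes from the kernel, the other from the denominator (2N+2-n)(2n+2) of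
    [wz_B]. *)
Lemma wz_B_bound (a : C) (N n : nat) :
  (Cmod a <= INR N)%R -> (n <= N)%nat ->
  (Cmod (wz_B a n (2 * N + 3)) <= / (INR N + 1) * / (INR N + 1))%R.
Proof.
  intros Ha Hn; unfold wz_B.
  pose proof (wz_kernel_bound a N n Ha Hn) as Hk.
  assert (HK : INR (2 * N + 3) = (2 * INR N + 3)%R)
    by (rewrite plus_INR, mult_INR; simpl; ring).
  pose proof (le_INR _ _ Hn); pose proof (pos_INR n).
  rewrite Cmod_div by (apply RtoC_neq; rewrite HK; nra).
  rewrite Cmod_R, Rabs_pos_eq by (rewrite HK; nra).
  apply Rmult_le_compat; [apply Cmod_ge_0 | | |].
  - left; apply Rinv_0_lt_compat; rewrite HK; nra.
  - eapply Rle_trans; [exact Hk|].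
    apply Rinv_le_contravar; rewrite ?HK; lra.
  - apply Rinv_le_contravar; rewrite ?HK; nra.
Qed.

Lemma Cmod_sum_n_le (f : nat -> C) (c : R) (n : nat) :
  (forall i, (i <= n)%nat -> (Cmod (f i) <= c)%R) ->
  (Cmod (sum_n f n) <= (INR n + 1) * c)%R.
Proof.
  induction n as [|n IH]; intros H.
  - rewrite sum_O; simpl; specialize (H 0%nat (le_n 0)); lra.
  - rewrite sum_Sn, S_INR.
    eapply Rle_trans; [apply Cmod_triangle|].
    specialize (IH (fun i Hi => H i (le_S _ _ Hi))).
    specialize (H (S n) (le_n _)); lra.
Qed.

Lemma wz_error_lim (a : C) :
  filterlim (fun N => sum_n (fun i => wz_B a i (2 * N + 3)) N)
    eventually (locally (zero : C_NormedModule)).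
Proof.
  apply (filterlim_norm_zero (K := C_AbsRing)).
  (* From N = N0+1 on, |a| <= N holds, and N+1 terms of size at most 1/(N+1)^2 sum to at most
     1/(N+1). *)
  destruct (nfloor_ex (Cmod a) (Cmod_ge_0 a)) as [N0 [_ HN0]].
  apply (is_lim_seq_le_le_loc (fun _ => 0%R) _ (fun N => / INR (S N))%R 0).
  - exists (S N0); intros N HN; split; [apply Cmod_ge_0|].
    change norm with Cmod.
    assert (Ha : (Cmod a <= INR N)%R)
      by (apply le_INR in HN; rewrite S_INR in HN; lra).
    eapply Rle_trans.
    + apply Cmod_sum_n_le; intros i Hi; apply (wz_B_bound a N i Ha Hi).
    + pose proof (pos_INR N); rewrite S_INR.
      rewrite <- Rmult_assoc, Rinv_r, Rmult_1_l by lra; lra.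
  - apply is_lim_seq_const.
  - apply (is_lim_seq_incr_1 (fun N => / INR N)%R).
    replace (Finite 0) with (Rbar_inv p_infty) by reflexivity.
    apply is_lim_seq_inv; [apply is_lim_seq_INR | discriminate].
Qed.

(** * Convergence of the left-hand series *)

(** Comparison series for the left-hand side; it telescopes, with partial sums 1 - 1/(n+2). *)
Lemma ex_series_inv_mul_succ :
  ex_series (fun j : nat => / ((INR j + 1) * (INR j + 2)))%R.
Proof.
  exists 1%R.
  change (is_lim_seq
    (sum_n (fun j : nat => / ((INR j + 1) * (INR j + 2)))%R) (Finite 1)).
  apply (is_lim_seq_ext (fun n => 1 - / INR (S (S n)))%R).
  - induction n as [|n IH].
    + rewrite sum_O; simpl; field.
    + rewrite sum_Sn, <- IH; change plus with Rplus; rewrite !S_INR.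
      pose proof (pos_INR n); field; lra.
  - replace (Finite 1) with (Rbar_minus (Finite 1) (Finite 0))
      by (simpl; f_equal; ring).
    apply is_lim_seq_minus'; [apply is_lim_seq_const|].
    apply (is_lim_seq_incr_1 (fun n => / INR (S n))%R).
    apply (is_lim_seq_incr_1 (fun n => / INR n)%R).
    replace (Finite 0) with (Rbar_inv p_infty) by reflexivity.
    apply is_lim_seq_inv; [apply is_lim_seq_INR | discriminate].
Qed.

Lemma ex_series_lhs (a : C) :
  (forall z : Z, z <> 0%Z -> a <> RtoC (IZR z)) ->
  ex_series (fun j : nat => lhs_term a (S j)).
Proof.
  intros ha.
  destruct (nfloor_ex (2 * Cmod a)) as [K [_ HK]];
    [pose proof (Cmod_ge_0 a); lra|].
  (* After dropping K+1 terms, the index k = K+j+2 exceeds 2|a|. *)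
  apply (ex_series_incr_n (K := C_AbsRing) (V := C_NormedModule) _ (S K)).
  refine (ex_series_le (K := C_AbsRing) (V := C_CompleteNormedModule) _ _ _
            ex_series_inv_mul_succ).
  intros j; change norm with Cmod; unfold lhs_term.
  pose proof (sqr_sub_neq_0 a (S (S K + j)) ha ltac:(lia)) as H.
  assert (Hk0 : INR (S (S K + j)) <> 0%R) by (apply not_0_INR; lia).
  assert (Hk : INR (S (S K + j)) = (INR K + INR j + 2)%R)
    by (rewrite S_INR, plus_INR, S_INR; ring).
  revert H Hk0 Hk; generalize (INR (S (S K + j))); intros k H Hk0 Hk.
  pose proof (pos_INR K); pose proof (pos_INR j); pose proof (Cmod_ge_0 a).
  rewrite Cmod_div by (apply Cmult_neq_0; [apply RtoC_neq|]; assumption).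
  rewrite Cmod_1, Cmod_mult, Cmod_R, Rabs_pos_eq by lra.
  (* The constant is 1 - 1/4, from |a| < k/2. *)
  assert (Hsub : (3 / 4 * k ^ 2 <= Cmod (RtoC k ^ 2 - a ^ 2))%R).
  { pose proof (Cmod_triangle (RtoC k ^ 2 - a ^ 2) (a ^ 2)) as T.
    replace (RtoC k ^ 2 - a ^ 2 + a ^ 2) with (RtoC k ^ 2) in T by ring.
    rewrite !Cmod_sqr, Cmod_R, Rabs_pos_eq in T by lra; nra. }
  unfold Rdiv; rewrite Rmult_1_l.
  apply Rinv_le_contravar; [nra|].
  apply Rle_trans with (k * (3 / 4 * k ^ 2))%R.
  (* Here k >= j+2 and k-1 >= j+1, while k-1 <= 3/4 k^2 for every real k. *)
  - apply Rle_trans with (k * (k - 1))%R; nra.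
  - apply Rmult_le_compat_l; lra.
Qed.

(** * Passage to the limit in the staircase identity *)

Theorem theorem1 (a : C)
  (ha : forall z : Z, z <> 0%Z -> a <> RtoC (IZR z)) :
  exists s : C,
    is_series (fun j : nat => lhs_term a (S j)) s /\
    is_series (fun j : nat => rhs_term a (S j)) s.
Proof.
  (* The staircase reaches only left-hand partial sums with an even number of terms, so convergence
     of that series is taken from a separate argument. *)
  destruct (ex_series_lhs a ha) as [s Hs].
  exists s; split; [exact Hs|].
  unfold is_series.
  apply (filterlim_ext
    (fun N => plus (sum_n (fun j => lhs_term a (S j)) (2 * N + 1))
                (sum_n (fun i => wz_B a i (2 * N + 3)) N))).
  { intros N; symmetry; apply partial_sum_rhs, ha. }
  replace s with (plus s zero : C_NormedModule) by apply plus_zero_r.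
  refine (filterlim_comp_2 _ _ plus _ (wz_error_lim a) (filterlim_plus _ _)).
  (* The partial sums at 2N+1 form a subsequence, so they tend to [s] as well. *)
  apply (filterlim_comp _ _ _ (fun N => (2 * N + 1)%nat) _ _ eventually);
    [|exact Hs].
  intros P [M HM]; exists M; intros N HN; apply HM; lia.
Qed.
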